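(* Let $r\ge 1$, let $m_1,\dots,m_r$ be positive integers and $s=\sum_{i=1}^r m_i$. Then $$\binom{s}{m_1,m_2,\dots,m_r}=\sum_{(B_1,B_2)\in\mathcal B}\binom{s-r+1}{S(B_2)-|B_2|}\cdot\binom{S(B_1)}{B_1}\cdot\binom{S(B_2)}{B_2},$$ where $\mathcal B$ is the set of all pairs $(B_1,B_2)$ with $x_1\in B_1\subset X=\{x_1,\dots,x_r\}$ and $B_2=X\setminus B_1$.
   Context: $X=\{x_1,\dots,x_r\}$ is a set of $r$ distinct indeterminates. The function $g$ on $X$ is given by $g(x_1)=m_1-1$ and $g(x_i)=m_i$ for $i>1$. For $B\subset X$ put $S(B)=\sum_{x\in B}g(x)$ and $\binom{S(B)}{B}=\dfrac{S(B)!}{\prod_{x\in B}g(x)!}$ (so $S(\emptyset)=0$ and $\binom{S(\emptyset)}{\emptyset}=1$). $|B|$ is the cardinality of $B$. $\binom{s}{m_1,\dots,m_r}=s!/(m_1!\cdots m_r!)$. *)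

(* Defs.v *)
From mathcomp Require Import all_boot.
Set Implicit Arguments.
Unset Strict Implicit.
Unset Printing Implicit Defensive.

(* The indeterminates are indexed by 'I_r, with x_1 passed explicitly. *)
Definition g (r : nat) (x1 : 'I_r) (m : 'I_r -> nat) (x : 'I_r) : nat :=
  if x == x1 then m x - 1 else m x.

Definition gsum (r : nat) (f : 'I_r -> nat) (B : {set 'I_r}) : nat :=
  \sum_(x in B) f x.

(* The truncated division is exact, by dvdn_prod_fact below. *)
Definition multinom (r : nat) (f : 'I_r -> nat) (B : {set 'I_r}) : nat :=
  (gsum f B)`! %/ \prod_(x in B) (f x)`!.

Lemma dvdn_prod_fact (r : nat) (f : 'I_r -> nat) (B : {set 'I_r}) :
  \prod_(x in B) (f x)`! %| (gsum f B)`!.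
Proof.
rewrite /gsum; elim/big_rec2: _ => // x b a _ IH.
apply: dvdn_trans (dvdn_mul (dvdnn _) IH) _.
have := bin_fact (leq_addr b (f x)); rewrite addKn => <-.
exact: dvdn_mull.
Qed.

(* Main.v *)
Require Import Defs.
From mathcomp Require Import all_boot zify.
Set Implicit Arguments.
Unset Strict Implicit.
Unset Printing Implicit Defensive.

(** Put [d i = m i - 1], [D A = \sum_(i in A) d i] and [x = m x1].  After clearing
    factorials the theorem becomes a Hurwitz-type convolution over the subsets [A]
    of [Y = X \ {x1}]: [R Y x = \sum_(A \subset Y) P A x * R (Y \ A) 0], where
    [R A x = (x + D A + 1) ... (x + D A + #|A|)] and
    [P A x = x (x + D A + 1) ... (x + D A + #|A| - 1)], with [P set0 x = 1].
    Both families satisfy the same difference equation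
    [F A x.+1 = F A x + \sum_(i in A) F (A :\ i) (x.+1 + d i)],
    so the convolution follows by induction on [#|Y|] and then on [x]; at [x = 0]
    only [A = set0] contributes. *)

Section HurwitzConvolution.
Variables (T : finType) (d : T -> nat).
Implicit Types (A B Y : {set T}) (x : nat).

Definition rising A x := (x + \sum_(i in A) d i + #|A|) ^_ #|A|.

Definition abel A x :=
  if #|A| is k.+1 then x * (x + \sum_(i in A) d i + k) ^_ k else 1.

Lemma rising_fact A x :
  rising A x * (x + \sum_(i in A) d i)`! = (x + \sum_(i in A) d i + #|A|)`!.
Proof.
by rewrite /rising -(ffact_fact (leq_addl (x + \sum_(i in A) d i) #|A|)) addnK.
Qed.

(** The argument is a successor because the pattern fails for the empty set at [0], where [abel] is
    [1] but the leading factor vanishes. *)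
Lemma abel_fact A x :
  abel A x.+1 * (x.+1 + \sum_(i in A) d i)`! =
  x.+1 * (x + \sum_(i in A) d i + #|A|)`!.
Proof.
rewrite /abel; case cardA: #|A| => [|k].
  by rewrite (cards0_eq cardA) big_set0 !addn0 mul1n factS.
rewrite -mulnA addnS -!addSn; congr (_ * _).
by rewrite -(ffact_fact (leq_addl (x.+1 + \sum_(i in A) d i) k)) addnK.
Qed.

Lemma abel0 A : abel A 0 = (A == set0).
Proof. by rewrite /abel -cards_eq0; case: #|A|. Qed.

Lemma sum_setD1 A i : i \in A ->
  \sum_(j in A) d j = d i + \sum_(j in A :\ i) d j.
Proof. by move=> Ai; rewrite (big_setD1 i Ai). Qed.

(** Moving [d i] from the sum to the argument makes all summands equal; what remains is
    [N.+1 ^_ n = N ^_ n + n * N ^_ n.-1]. *)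
Lemma rising_rec A x :
  rising A x.+1 = rising A x + \sum_(i in A) rising (A :\ i) (x.+1 + d i).
Proof.
set D := \sum_(i in A) d i.
have -> : \sum_(i in A) rising (A :\ i) (x.+1 + d i) =
          \sum_(i in A) (x + D + #|A|) ^_ #|A|.-1.
  apply: eq_bigr => i Ai; rewrite /rising /D (sum_setD1 Ai) (cardsD1 i A) Ai /=.
  by congr (_ ^_ _); lia.
rewrite sum_nat_const /rising -/D; case: #|A| => [|k]; first by rewrite !ffactn0.
rewrite !addSn ffactSS ffactnSr /=; set f := _ ^_ k.
have -> : x + D + k.+1 - k = (x + D).+1 by lia.
nia.
Qed.

(** As for [rising], except that each summand keeps its leading factor [x.+1 + d i]; these add up to
    [#|A| * x.+1 + D]. *)
Lemma abel_rec A x :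
  abel A x.+1 = abel A x + \sum_(i in A) abel (A :\ i) (x.+1 + d i).
Proof.
have [A0 | A_gt0] := posnP #|A|.
  by rewrite /abel A0 (cards0_eq A0) big_set0.
set D := \sum_(i in A) d i.
(* For a singleton, [A :\ i] is empty and [abel] takes its default value [1]. *)
have [A1 | A_neq1] := eqVneq #|A| 1.
  have -> : \sum_(i in A) abel (A :\ i) (x.+1 + d i) = \sum_(i in A) 1.
    apply: eq_bigr => i Ai; have [cardAi] : #|A :\ i|.+1 = 1.
      by rewrite -A1 (cardsD1 i A) Ai.
    by rewrite /abel cardAi.
  by rewrite sum_nat_const /abel A1 !ffactn0; lia.
have [k Ak] : exists k, #|A| = k.+2 by exists (#|A| - 2); lia.
have -> : \sum_(i in A) abel (A :\ i) (x.+1 + d i) =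
          \sum_(i in A) (x.+1 + d i) * (x + D + k.+1) ^_ k.
  apply: eq_bigr => i Ai; have [cardAi] : #|A :\ i|.+1 = k.+2.
    by rewrite -Ak (cardsD1 i A) Ai.
  rewrite /abel cardAi /D (sum_setD1 Ai).
  by congr (_ * _ ^_ _); lia.
rewrite -big_distrl /= big_split /= sum_nat_const /abel Ak -/D.
rewrite [x.+1 + D]addSn [(x + D).+1 + _]addSn ffactSS ffactnSr; set f := _ ^_ k.
have -> : x + D + k.+1 - k = (x + D).+1 by lia.
nia.
Qed.

Lemma exchange_setD1 Y (F : T -> {set T} -> nat) :
  \sum_(A : {set T} | A \subset Y) \sum_(i in A) F i (A :\ i) =
  \sum_(i in Y) \sum_(A : {set T} | A \subset Y :\ i) F i A.
Proof.
rewrite (exchange_big_dep (mem Y)) /=; last by move=> A i /subsetP/(_ i).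
apply: eq_bigr => i Yi.
rewrite (reindex_onto (fun A => i |: A) (fun A => A :\ i)) /=; last first.
  by move=> A /andP[_ Ai]; rewrite setD1K.
apply: eq_big => [A | A /andP[_ /eqP -> //]].
rewrite setU11 andbT subUset sub1set Yi /= subsetD1.
congr (_ && _); apply/eqP/idP => [<- | Ai]; first by rewrite setD11.
by rewrite setU1K.
Qed.

Lemma hurwitz_convolution Y x :
  \sum_(A : {set T} | A \subset Y) abel A x * rising (Y :\: A) 0 = rising Y x.
Proof.
(* The outer hypothesis stays general in [x]: it is applied to [Y :\ i] at [x.+1 + d i]. *)
have [n] := ubnP #|Y|; elim: n Y x => // n IHn Y x leYn.
elim: x => [|x IHx].
  rewrite (bigD1 set0) ?sub0set //= abel0 eqxx mul1n setD0.
  by rewrite big1 ?addn0 // => A /andP[_ /negPf A0]; rewrite abel0 A0.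
rewrite rising_rec -IHx.
under [LHS]eq_bigr do rewrite abel_rec mulnDl big_distrl /=.
rewrite big_split /=; congr (_ + _).
(* For [i \in A], [Y :\: A] equals [(Y :\ i) :\: (A :\ i)], so the summand depends on [A] only
   through [A :\ i]. *)
pose F i A := abel A (x.+1 + d i) * rising (Y :\ i :\: A) 0.
transitivity (\sum_(A : {set T} | A \subset Y) \sum_(i in A) F i (A :\ i)).
  apply: eq_bigr => A _; apply: eq_bigr => i Ai.
  by rewrite /F setDDl setD1K.
rewrite exchange_setD1; apply: eq_bigr => i Yi; apply: IHn.
by move: leYn; rewrite (cardsD1 i Y) Yi.
Qed.

End HurwitzConvolution.

Lemma multinom_mul r (f : 'I_r -> nat) (B : {set 'I_r}) :
  multinom f B * \prod_(x in B) (f x)`! = (gsum f B)`!.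
Proof. exact: divnK (dvdn_prod_fact f B). Qed.

Lemma sum_predn (T : finType) (f : T -> nat) (B : {set T}) :
  {in B, forall i, 0 < f i} ->
  \sum_(i in B) f i = \sum_(i in B) (f i).-1 + #|B|.
Proof.
move=> f_gt0; rewrite -sum1_card -big_split /=.
by apply: eq_bigr => i /f_gt0 fi; rewrite addn1 prednK.
Qed.

(** The binomial splits the factorial of [m x1 + D Y] into those of [D B] and [m x1 + D A]; [rising]
    and [abel] turn these into the numerators of the two multinomials, up to a factor [m x1]. *)
Lemma term_clear_fact r (x1 : 'I_r) (m : 'I_r -> nat) (A : {set 'I_r}) :
  (forall i, 0 < m i) -> A \subset ~: [set x1] ->
  let d i := (m i).-1 in
  let Y := ~: [set x1] in
  let B := Y :\: A in
  'C(m x1 + \sum_(i in Y) d i, gsum (g x1 m) B - #|B|)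
    * multinom (g x1 m) (x1 |: A) * multinom (g x1 m) B
    * \prod_i (m i)`! =
  (m x1 + \sum_(i in Y) d i)`! * (abel d A (m x1) * rising d B 0).
Proof.
move=> m_gt0 sAY d Y B.
have x1A : x1 \notin A by move/subsetP: sAY => /(_ x1); rewrite !inE eqxx => /contraL->.
have gE i : i \in Y -> g x1 m i = m i by rewrite !inE /g => /negPf ->.
have sBY : B \subset Y := subsetDl Y A.
have gEA i : i \in A -> g x1 m i = m i by move/(subsetP sAY); apply: gE.
have gEB i : i \in B -> g x1 m i = m i by move/(subsetP sBY); apply: gE.
have sumB : gsum (g x1 m) B = \sum_(i in B) d i + #|B|.
  rewrite /gsum (eq_bigr _ gEB); apply: sum_predn => i _; apply: m_gt0.
have [a m1E] : exists a, m x1 = a.+1 by exists (m x1).-1; rewrite prednK.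
have g1 : g x1 m x1 = a by rewrite /g eqxx m1E subn1.
have sumA : gsum (g x1 m) (x1 |: A) = a + \sum_(i in A) d i + #|A|.
  rewrite /gsum (big_setU1 _ x1A) /= (eq_bigr _ gEA) g1.
  by rewrite (sum_predn (fun i _ => m_gt0 i)) addnA.
have splitY (R : Type) (idx : R) (op : Monoid.com_law idx) (F : 'I_r -> R) :
    \big[op/idx]_(i in Y) F i =
    op (\big[op/idx]_(i in A) F i) (\big[op/idx]_(i in B) F i).
  by rewrite [LHS](big_setID A) /= (setIidPr sAY).
(* The factor [a.+1] appears because [g] lowers the value at [x1] by one; [abel_fact] absorbs it. *)
have prodE : \prod_i (m i)`! =
    a.+1 * (\prod_(i in x1 |: A) (g x1 m i)`! * \prod_(i in B) (g x1 m i)`!).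
  rewrite (bigD1 x1) //= m1E factS (big_setU1 _ x1A) /= g1.
  rewrite (eq_bigl (fun i => i \in Y)); last by move=> i; rewrite !inE.
  rewrite splitY /= !mulnA; congr (_ * _ * _); apply: eq_bigr => i Hi.
    by rewrite gEA.
  by rewrite gEB.
rewrite prodE; set M1 := multinom _ _; set M2 := multinom _ _.
set p1 := \prod_(i in _ |: _) _; set p2 := \prod_(i in B) _.
have M1E : M1 * p1 = (a + \sum_(i in A) d i + #|A|)`! by rewrite -sumA multinom_mul.
have M2E : M2 * p2 = (0 + \sum_(i in B) d i + #|B|)`!.
  by rewrite add0n -sumB multinom_mul.
have PE := abel_fact d A a.
have RE := rising_fact d B 0; rewrite -M2E in RE; rewrite -M1E in PE.
rewrite sumB addnK m1E splitY /=.
set DA := \sum_(i in A) d i in PE *; set DB := \sum_(i in B) d i in RE *.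
have := bin_fact (leq_trans (leq_addl DA DB) (leq_addl a.+1 (DA + DB))).
rewrite [in (_ - DB)]addnA addnK => <-.
rewrite add0n in RE; set C := 'C(_, _).
transitivity (C * (a.+1 * (M1 * p1)) * (M2 * p2)); first nia.
by rewrite -PE -RE; nia.
Qed.

Theorem theorem5p11 (r : nat) (hr : 1 <= r) (m : 'I_r -> nat)
    (hm : forall i : 'I_r, 0 < m i) (s : nat) (hs : s = \sum_(i < r) m i) :
  let x1 : 'I_r := Ordinal hr in
  s`! %/ \prod_(i < r) (m i)`! =
  \sum_(B : {set 'I_r} * {set 'I_r} | (x1 \in B.1) && (B.2 == [set: 'I_r] :\: B.1))
    'C(s - r + 1, gsum (g x1 m) B.2 - #|B.2|)
    * multinom (g x1 m) B.1 * multinom (g x1 m) B.2.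
Proof.
move=> x1; pose d i := (m i).-1; pose Y := ~: [set x1].
have sE : s = m x1 + \sum_(i in Y) d i + #|Y|.
  rewrite hs (bigD1 x1) //= -addnA -sum_predn => [|i _]; last exact: hm.
  by congr (_ + _); apply: eq_bigl => i; rewrite !inE.
(* The subtraction is not truncated: [#|Y| = r - 1] and [0 < m x1] give [r <= s]. *)
have topE : s - r + 1 = m x1 + \sum_(i in Y) d i.
  have := cardsC1 x1; rewrite card_ord -/Y => cardY.
  by rewrite sE cardY; have := hm x1; lia.
have prod_gt0 : 0 < \prod_(i < r) (m i)`!.
  by apply: prodn_gt0 => i; apply: fact_gt0.
apply/eqP; rewrite -(eqn_pmul2r prod_gt0) divnK; last first.
  rewrite hs; have := dvdn_prod_fact m [set: 'I_r].
  by rewrite /gsum !(eq_bigl _ _ (in_setT (T := _))).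
apply/eqP; rewrite topE big_distrl /=.
(* A pair is determined by [A = B.1 :\ x1], which ranges over the subsets of [Y]. *)
rewrite (reindex_onto (fun A => (x1 |: A, Y :\: A)) (fun B => B.1 :\ x1)) /=;
  last first.
  case=> B1 B2 /= /andP[x1B1 /eqP->]; rewrite setD1K //; congr (_, _).
  apply/setP=> i; rewrite !inE; case: eqP => [->|] //=.
  by rewrite x1B1.
rewrite (eq_bigl (fun A : {set _} => A \subset Y)) => [|A]; last first.
  rewrite setU11 setTD setCU -setDE eqxx /= subsetC sub1set inE.
  apply/eqP/idP => [<- | Ax1]; first by rewrite setD11.
  by rewrite setU1K.
rewrite (eq_bigr _ (fun A sAY => term_clear_fact hm sAY)) -big_distrr /=.
by rewrite hurwitz_convolution mulnC rising_fact -sE.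
Qed.
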